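(* Let $f$ be a transcendental entire function of finite order and positive lower order, i.e. $\rho(f)<\infty$ and $\lambda(f)>0$. Then $f$ is strongly log-regular and hence $Q_2(f)=A(f)$.
   Context: For a transcendental entire function $f$, $f^n$ denotes the $n$th iterate, and $M(r)=M(r,f)=\max_{|z|=r}|f(z)|$ for $r>0$; $M^n(r,f)$ denotes the $n$th iterate of the function $r\mapsto M(r,f)$. Order and lower order: $\rho(f)=\limsup_{r\to\infty}\frac{\log\log M(r,f)}{\log r}$, $\lambda(f)=\liminf_{r\to\infty}\frac{\log\log M(r,f)}{\log r}$. A transcendental entire function $f$ is strongly log-regular if, for every $\varepsilon\in(0,1)$, there exist $R>0$ and $k>1$ such that $\log M(r^k)\ge(k\log M(r))^{1/\varepsilon}$ for all $r>R$. Fast escaping set: $A(f)=\{z\in\mathbb{C}:\text{ there exists }\ell\in\mathbb{N}\text{ such that }|f^{n+\ell}(z)|\ge M^n(R,f)\text{ for all }n\in\mathbb{N}\}$, where $R>0$ is large enough that $M(r,f)>r$ for all $r\ge R$ (the set does not depend on the choice of such $R$). For $\varepsilon\in(0,1)$ let $\mu_{2,\varepsilon}(r)=\exp((\log M(r,f))^{\varepsilon})$, defined for $r$ with $M(r,f)\ge 1$, and let $\mu_{2,\varepsilon}^n$ denote its $n$th iterate. The set $Q_2(f)$ consists of all $z\in\mathbb{C}$ for which there exist $\varepsilon\in(0,1)$, $\ell\in\mathbb{N}$ and $R>0$ with $\mu_{2,\varepsilon}(r)>r$ for all $r\ge R$, such that $|f^{n+\ell}(z)|\ge\mu_{2,\varepsilon}^n(R)$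 for all $n\in\mathbb{N}$ (for given $\varepsilon$ the choice of such $R$ does not affect the set). *)

(* Defs.v *)
From Stdlib Require Import Reals.
From Coquelicot Require Import Coquelicot.
Open Scope R_scope.

Definition entire (f : C -> C) : Prop :=
  forall z : C, @ex_derive C_AbsRing C_NormedModule f z.

Definition polynomial_function (f : C -> C) : Prop :=
  exists (d : nat) (a : nat -> C),
    forall z : C, f z = sum_n (fun k => Cmult (a k) (Cpow z k)) d.

Definition transcendental_entire (f : C -> C) : Prop :=
  entire f /\ ~ polynomial_function f.

(** For [f] continuous and [0 <= r] the supremum is finite and attained, so it
    is the maximum over the circle. *)
Definition max_modulus (f : C -> C) (r : R) : R :=
  real (Lub_Rbar (fun y => exists z : C, Cmod z = r /\ y = Cmod (f z))).

Definition limsup_infty (g : R -> R) : Rbar :=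
  Rbar_glb (fun s => exists r0 : R,
    s = Lub_Rbar (fun y => exists r : R, r0 < r /\ y = g r)).

Definition liminf_infty (g : R -> R) : Rbar :=
  Rbar_lub (fun i => exists r0 : R,
    i = Glb_Rbar (fun y => exists r : R, r0 < r /\ y = g r)).

Definition growth_order (f : C -> C) : Rbar :=
  limsup_infty (fun r => ln (ln (max_modulus f r)) / ln r).

Definition growth_lower_order (f : C -> C) : Rbar :=
  liminf_infty (fun r => ln (ln (max_modulus f r)) / ln r).

(** [x ^ a] for [0 <= x] and [0 < a]; [Rpower] is not suitable because
    [Rpower 0 a = 1]. *)
Definition nnpow (x a : R) : R :=
  if Rlt_dec 0 x then Rpower x a else 0.

Definition strongly_log_regular (f : C -> C) : Prop :=
  forall eps : R, 0 < eps < 1 ->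
  exists R0 k : R, 0 < R0 /\ 1 < k /\
    forall r : R, R0 < r ->
      ln (max_modulus f (Rpower r k)) >= nnpow (k * ln (max_modulus f r)) (1 / eps).

(** The set [A(f)] does not depend on the admissible [R0], so [R0] is
    quantified existentially. Likewise it does not matter whether [n] and [l]
    range over the positive or the nonnegative integers. *)
Definition fast_escaping (f : C -> C) (z : C) : Prop :=
  exists R0 : R, 0 < R0 /\
    (forall r : R, R0 <= r -> max_modulus f r > r) /\
    exists l : nat, forall n : nat,
      Cmod (Nat.iter (n + l) f z) >= Nat.iter n (max_modulus f) R0.

Definition mu2 (f : C -> C) (eps r : R) : R :=
  exp (nnpow (ln (max_modulus f r)) eps).

(** [mu2 f eps r] is meaningful only when [1 <= max_modulus f r], so an
    admissible [R0] must ensure this for all [r >= R0]; the iterates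
    at [R0] then stay in that range. *)
Definition Q2 (f : C -> C) (z : C) : Prop :=
  exists (eps : R) (l : nat) (R0 : R), 0 < eps < 1 /\ 0 < R0 /\
    (forall r : R, R0 <= r -> 1 <= max_modulus f r /\ mu2 f eps r > r) /\
    forall n : nat,
      Cmod (Nat.iter (n + l) f z) >= Nat.iter n (mu2 f eps) R0.

(* Main.v *)
Require Import Defs.
From Stdlib Require Import Reals Lra Classical.
From Coquelicot Require Import Coquelicot.
Open Scope R_scope.

(** Finite order and positive lower order give [r ^ b <= ln M(r) <= r ^ A] for
    large [r], with [0 < b] and [0 < A]. Strong log-regularity follows by taking
    [k * b >= A / eps + 1]. For [A(f)] in [Q2(f)], choose [eps] with [A * eps <= b]:
    then [mu(s) <= exp (s ^ (A * eps)) <= exp (t ^ b) <= M(t)] whenever [s <= t].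
    Conversely, for given [eps] put [k = (A + 1) / (b * eps)]: then [r ^ k <= s]
    implies [mu(s) >= exp (s ^ (b * eps)) >= exp (r * r ^ A) >= M(r) ^ k].
    Both comparisons go through the power bounds, so monotonicity of [M] (the
    maximum principle) is never needed; lower semicontinuity of [M] is enough
    for its iterates to be unbounded. *)

(** The product uniform structure on the domain allows composition with curves given by two real
    coordinates; [locally_C] links it to the one underlying [ex_derive]. *)
Lemma entire_Cmod_continuous (f : C -> C) (hf : entire f) (z : C) :
  @continuous (prod_UniformSpace R_UniformSpace R_UniformSpace) R_UniformSpace
    (fun w => Cmod (f w)) z.
Proof.
assert (hc := @ex_derive_continuous C_AbsRing C_NormedModule f z (hf z)).
apply (filterlim_comp _ _ _ f Cmod _ (@locally C_NormedModule (f z))).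
- intros P hP. exact (proj2 (locally_C z _) (hc P hP)).
- exact (@filterlim_norm C_AbsRing C_NormedModule (f z)).
Qed.

(** * Power bounds for [ln M] from order and lower order *)

(** If no tail of [g] were bounded above, every tail supremum would be [p_infty], and so would their
    infimum. *)
Lemma limsup_lt_p_infty (g : R -> R) :
  Rbar_lt (limsup_infty g) p_infty ->
  exists A r0 : R, forall r : R, r0 < r -> g r <= A.
Proof.
intros h. apply NNPP. intros hn.
unfold limsup_infty in h.
match type of h with Rbar_lt (Rbar_glb ?E) _ =>
  destruct (proj2_sig (Rbar_ex_glb E)) as [_ hg] end.
apply (Rbar_lt_not_le _ _ h). apply hg.
intros s [r0 ->].
destruct (Lub_Rbar_correct (fun y => exists r : R, r0 < r /\ y = g r)) as [hu _].
destruct (Lub_Rbar _) as [A| |] eqn:e; simpl; auto.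
- apply hn. exists A, r0. intros r hr. apply (hu (g r)). eauto.
- assert (H := hu (g (r0 + 1)) (ex_intro _ (r0 + 1) (conj (Rlt_plus_1 r0) eq_refl))).
  exact H.
Qed.

Lemma liminf_gt (g : R -> R) (a : R) :
  Rbar_lt (Finite a) (liminf_infty g) ->
  exists b r0 : R, a < b /\ forall r : R, r0 < r -> b <= g r.
Proof.
intros h. apply NNPP. intros hn.
unfold liminf_infty in h.
match type of h with Rbar_lt _ (Rbar_lub ?E) =>
  destruct (proj2_sig (Rbar_ex_lub E)) as [_ hg] end.
apply (Rbar_lt_not_le _ _ h). apply hg.
intros s [r0 ->].
destruct (Glb_Rbar_correct (fun y => exists r : R, r0 < r /\ y = g r)) as [hu _].
destruct (Glb_Rbar _) as [b| |] eqn:e; simpl; auto.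
- apply Rnot_lt_le. intros hab. apply hn. exists b, r0. split; [easy|].
  intros r hr. apply (hu (g r)). eauto.
- assert (H := hu (g (r0 + 1)) (ex_intro _ (r0 + 1) (conj (Rlt_plus_1 r0) eq_refl))).
  exact H.
Qed.

(** Positivity of [x] comes for free: [ln] has the default value 0 at nonpositive arguments. *)
Lemma ln_pos_arg (x : R) : 0 < ln x -> 1 < x.
Proof.
intros h. destruct (Rlt_dec 0 x) as [hx|hx].
- apply ln_lt_inv; try lra. rewrite ln_1; lra.
- exfalso. revert h. unfold ln. destruct (Rlt_dec 0 x); [easy|lra].
Qed.

Lemma exp_le (x y : R) : x <= y -> exp x <= exp y.
Proof.
intros [h| ->]; [left; now apply exp_increasing | right; easy].
Qed.

Lemma growth_bounds (f : C -> C)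
  (horder : Rbar_lt (growth_order f) p_infty)
  (hlower : Rbar_lt (Finite 0) (growth_lower_order f)) :
  exists A b r0 : R, 0 < A /\ 0 < b <= 1 /\ 1 <= r0 /\
    forall r : R, r0 <= r ->
      Rpower r b <= ln (max_modulus f r) <= Rpower r A.
Proof.
destruct (limsup_lt_p_infty _ horder) as (A & r1 & hA).
destruct (liminf_gt _ _ hlower) as (b & r2 & hb0 & hb).
(* Truncation at 1 yields [0 < A] and [b <= 1]; the final [+ 1] makes both tail conditions and
   [0 < ln r] strict. *)
exists (Rmax A 1), (Rmin b 1), (Rmax 1 (Rmax r1 r2) + 1).
assert (h1 := Rmax_l 1 (Rmax r1 r2)). assert (h2 := Rmax_r 1 (Rmax r1 r2)).
assert (h3 := Rmax_l r1 r2). assert (h4 := Rmax_r r1 r2).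
assert (h5 := Rmax_r A 1). assert (h6 := Rmax_l A 1).
assert (h7 := Rmin_r b 1). assert (h8 := Rmin_l b 1).
assert (h9 : 0 < Rmin b 1) by (apply Rmin_glb_lt; lra).
repeat split; try lra.
all: assert (hl : 0 < ln r) by (rewrite <- ln_1; apply ln_increasing; lra).
all: specialize (hA r ltac:(lra)); specialize (hb r ltac:(lra)); simpl in hA, hb.
all: set (L := ln (max_modulus f r)) in *.
all: apply (Rmult_le_compat_r (ln r)) in hA; [|lra].
all: apply (Rmult_le_compat_r (ln r)) in hb; [|lra].
all: unfold Rdiv in hA, hb; rewrite Rmult_assoc, Rinv_l, Rmult_1_r in hA, hb by lra.
all: assert (hbl : 0 < b * ln r) by (apply Rmult_lt_0_compat; lra).
all: assert (hL : 1 < L) by (apply ln_pos_arg; lra).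
all: rewrite <- (exp_ln L) by lra; unfold Rpower; apply exp_le.
- apply Rle_trans with (2 := hb). apply Rmult_le_compat_r; lra.
- apply Rle_trans with (1 := hA). apply Rmult_le_compat_r; lra.
Qed.

(** * Strong log-regularity *)

Lemma Rpower_ge_1 (r a : R) : 1 <= r -> 0 <= a -> 1 <= Rpower r a.
Proof.
intros hr ha. rewrite <- (Rpower_O r) by lra. apply Rle_Rpower; lra.
Qed.

(** With [t = ln r] the claim is [t < exp (c t)]. Here [exp (c t) >= (1 + c t / 2) ^ 2 > c ^ 2 t ^ 2
    / 4], and this is at least [t] once [c ^ 2 t >= 4]. *)
Lemma lt_exp_Rpower (c r : R) : 0 < c -> exp (4 / c ^ 2) <= r -> r < exp (Rpower r c).
Proof.
intros hc hr.
assert (hr0 : 0 < r) by (apply Rlt_le_trans with (2 := hr); apply exp_pos).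
rewrite <- (exp_ln r) at 1 by easy. apply exp_increasing. unfold Rpower.
assert (ht : 4 / c ^ 2 <= ln r).
{ rewrite <- (ln_exp (4 / c ^ 2)). apply ln_le; [apply exp_pos | easy]. }
set (t := ln r) in *.
assert (hct : 4 <= c ^ 2 * t).
{ replace 4 with (c ^ 2 * (4 / c ^ 2)) by (field; lra).
  apply Rmult_le_compat_l; [apply pow2_ge_0 | easy]. }
assert (ht0 : 0 < t).
{ apply Rlt_le_trans with (2 := ht). apply Rdiv_lt_0_compat; [lra|]. apply pow_lt; lra. }
replace (c * t) with (c * t / 2 + c * t / 2) by field.
rewrite exp_plus.
assert (he := exp_ineq1_le (c * t / 2)).
assert (hct0 : 0 < c * t) by (apply Rmult_lt_0_compat; lra).
apply Rlt_le_trans with ((1 + c * t / 2) * (1 + c * t / 2)).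
- assert (4 * t <= c ^ 2 * t * t) by (apply Rmult_le_compat_r; lra). nra.
- apply Rmult_le_compat; lra.
Qed.

Lemma nnpow_pos (x a : R) : 0 < x -> nnpow x a = Rpower x a.
Proof.
intros hx. unfold nnpow. destruct (Rlt_dec 0 x); [easy|lra].
Qed.

Lemma power_growth_strongly_log_regular (f : C -> C) (A b r0 : R) :
  0 < A -> 0 < b <= 1 -> 1 <= r0 ->
  (forall r : R, r0 <= r -> Rpower r b <= ln (max_modulus f r) <= Rpower r A) ->
  strongly_log_regular f.
Proof.
intros hA hb hr0 hM eps heps.
set (k := (A / eps + 1) / b + 1).
assert (hAe : 0 < A / eps) by (apply Rdiv_lt_0_compat; lra).
assert (hk1 : 0 < (A / eps + 1) / b) by (apply Rdiv_lt_0_compat; lra).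
assert (hk : 1 < k) by (unfold k; lra).
assert (hkb : A / eps + 1 <= k * b).
{ unfold k. replace (((A / eps + 1) / b + 1) * b) with (A / eps + 1 + b) by (field; lra). lra. }
assert (he : 0 < 1 / eps) by (apply Rdiv_lt_0_compat; lra).
(* Beyond the second threshold, the spare factor [r] in [r ^ (A / eps + 1)] absorbs
   [k ^ (1 / eps)]. *)
exists (Rmax r0 (Rpower k (1 / eps))), k.
assert (h1 := Rmax_l r0 (Rpower k (1 / eps))).
assert (h2 := Rmax_r r0 (Rpower k (1 / eps))).
repeat split; try lra.
intros r hr. apply Rle_ge.
assert (hrk : r <= Rpower r k).
{ rewrite <- (Rpower_1 r) at 1 by lra. apply Rle_Rpower; lra. }
assert (hL := hM r ltac:(lra)).
assert (hLk := hM (Rpower r k) ltac:(lra)).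
assert (hrb : 1 <= Rpower r b) by (apply Rpower_ge_1; lra).
rewrite nnpow_pos by (apply Rmult_lt_0_compat; lra).
apply Rle_trans with (2 := proj1 hLk).
rewrite Rpower_mult.
apply Rle_trans with (Rpower (k * Rpower r A) (1 / eps)).
{ apply Rle_Rpower_l; [lra|]. split; [apply Rmult_lt_0_compat; lra|].
  apply Rmult_le_compat_l; lra. }
rewrite <- Rpower_mult_distr; [|lra|apply exp_pos].
rewrite Rpower_mult.
apply Rle_trans with (Rpower r (A / eps + 1)); [|apply Rle_Rpower; lra].
rewrite Rplus_comm, Rpower_plus, Rpower_1 by lra.
replace (A * (1 / eps)) with (A / eps) by (field; lra).
apply Rmult_le_compat_r; [left; apply exp_pos | lra].
Qed.

(** * Iteration of real functions *)

(* The local condition is used at the supremum [x] of a bounded orbit: an iterate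
   close to [x] would be sent to [x] or beyond. *)
Lemma iter_unbounded (g : R -> R) (a : R) :
  (forall x : R, a <= x -> x < g x) ->
  (forall x : R, a <= x -> exists d : R, 0 < d /\
     forall y : R, a <= y -> x - d < y < x -> x <= g y) ->
  forall B : R, exists n : nat, B <= Nat.iter n g a.
Proof.
intros hg hl B. apply NNPP. intros hn.
assert (ha : forall n, a <= Nat.iter n g a).
{ induction n as [|n IH]; simpl; [lra|]. specialize (hg _ IH). lra. }
set (E := fun y => exists n, y = Nat.iter n g a).
destruct (completeness E) as [x [hu hx]].
{ exists B. intros y [n ->]. apply Rnot_lt_le. intros h. apply hn. exists n. lra. }
{ exists a, 0%nat. easy. }
assert (hlt : forall n, Nat.iter n g a < x).
{ intros n. apply Rlt_le_trans with (1 := hg _ (ha n)). apply hu. exists (S n). easy. }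
destruct (hl x) as (d & hd & hd'); [left; apply (hlt 0%nat)|].
assert (hex : exists n, x - d < Nat.iter n g a).
{ apply NNPP. intros h. apply (Rlt_not_le x (x - d)); [lra|].
  apply hx. intros y [n ->]. apply Rnot_lt_le. intros h'. apply h. now exists n. }
destruct hex as [n h].
apply (Rlt_not_le _ _ (hlt (S n))). simpl. apply hd'; auto.
Qed.

(** Applied to relations that also keep the first orbit above a threshold, where the one-step
    comparison is valid. *)
Lemma iter_rel (P : R -> R -> Prop) (g h : R -> R) (x y : R) (n : nat) :
  (forall s t : R, P s t -> P (g s) (h t)) -> P x y ->
  P (Nat.iter n g x) (Nat.iter n h y).
Proof.
intros hP hxy. induction n as [|n IH]; simpl; auto.
Qed.

(** * Lower semicontinuity of the maximum modulus *)

Lemma Cmod_sqr (z : C) : Cmod z * Cmod z = fst z * fst z + snd z * snd z.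
Proof.
unfold Cmod. rewrite sqrt_sqrt; [ring|]. nra.
Qed.

Lemma entire_Cmod_curve_continuous (f : C -> C) (hf : entire f) (u v : R -> R) (x : R) :
  continuous u x -> continuous v x ->
  continuous (fun t => Cmod (f (u t, v t))) x.
Proof.
intros hu hv.
apply (continuous_comp_2 u v (fun a b => Cmod (f (a, b))) x hu hv).
apply continuous_ext with (fun w : C => Cmod (f w)).
- now intros [a b].
- apply entire_Cmod_continuous, hf.
Qed.

(* The circle is covered by the graphs of [t |-> s * sqrt (r ^ 2 - t ^ 2)], [s = 1, -1]. *)
Lemma entire_bounded_on_circle (f : C -> C) (hf : entire f) (r : R) :
  0 <= r -> exists B : R, forall z : C, Cmod z = r -> Cmod (f z) <= B.
Proof.
intros hr.
assert (half : forall s : R, exists B : R, forall t : R, - r <= t <= r ->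
  Cmod (f (t, s * sqrt (r * r - t * t))) <= B).
{ intros s.
  destruct (continuity_ab_maj (fun t => Cmod (f (t, s * sqrt (r * r - t * t)))) (- r) r)
    as [m [hm _]]; [lra| |eexists; exact hm].
  intros t _. apply continuity_pt_filterlim.
  apply (entire_Cmod_curve_continuous f hf (fun t => t) (fun t => s * sqrt (r * r - t * t))).
  - apply continuous_id.
  - apply (continuous_mult (K := R_AbsRing)); [apply continuous_const|].
    apply continuous_sqrt_comp. apply (continuous_minus (V := R_NormedModule)).
    + apply continuous_const.
    + apply (continuous_mult (K := R_AbsRing)); apply continuous_id. }
destruct (half 1) as [B1 h1]. destruct (half (- 1)) as [B2 h2].
exists (Rmax B1 B2). intros [a b] hz.
assert (hs := Cmod_sqr (a, b)). rewrite hz in hs. simpl in hs.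
assert (ha : - r <= a <= r) by (split; nra).
assert (hb2 : r * r - a * a = Rsqr b) by (unfold Rsqr; lra).
specialize (h1 a ha). specialize (h2 a ha). rewrite hb2 in h1, h2.
destruct (Rle_dec 0 b) as [hb|hb].
- apply Rle_trans with (2 := Rmax_l _ _).
  now rewrite sqrt_Rsqr, Rmult_1_l in h1 by lra.
- apply Rle_trans with (2 := Rmax_r _ _).
  rewrite Rsqr_neg, sqrt_Rsqr in h2 by lra.
  now replace (-1 * - b) with b in h2 by ring.
Qed.

(** [real] sends [p_infty] to 0, so boundedness on the circle is what rules out an infinite
    supremum. *)
Lemma Cmod_le_max_modulus (f : C -> C) (hf : entire f) (z : C) :
  Cmod (f z) <= max_modulus f (Cmod z).
Proof.
destruct (entire_bounded_on_circle f hf (Cmod z) (Cmod_ge_0 z)) as [B hB].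
unfold max_modulus.
destruct (Lub_Rbar_correct (fun y => exists w : C, Cmod w = Cmod z /\ y = Cmod (f w)))
  as [hu hl].
assert (h1 := hu (Cmod (f z)) (ex_intro _ z (conj eq_refl eq_refl))).
assert (h2 : Rbar_le (Lub_Rbar (fun y => exists w : C, Cmod w = Cmod z /\ y = Cmod (f w))) B).
{ apply hl. intros y [w [hw ->]]. now apply hB. }
destruct (Lub_Rbar _); simpl in *; easy.
Qed.

(** Without a witness the supremum is at most [c], or is [m_infty] on an empty circle; [0 <= c]
    covers the default 0 in the latter case. *)
Lemma max_modulus_gt_witness (f : C -> C) (r c : R) :
  0 <= c < max_modulus f r -> exists z : C, Cmod z = r /\ c < Cmod (f z).
Proof.
intros [hc h]. apply NNPP. intros hn. revert h. apply Rle_not_lt. unfold max_modulus.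
destruct (Lub_Rbar_correct (fun y => exists z : C, Cmod z = r /\ y = Cmod (f z))) as [_ hl].
assert (h : Rbar_le (Lub_Rbar (fun y => exists z : C, Cmod z = r /\ y = Cmod (f z))) c).
{ apply hl. intros y [w [hw ->]]. apply Rnot_lt_le. eauto. }
destruct (Lub_Rbar _); simpl in *; easy.
Qed.

(** A point of modulus [x] where [Cmod (f z)] exceeds [c] is moved along its ray to modulus [y]; by
    continuity the value still exceeds [c] for [y] near [x]. *)
Lemma max_modulus_lower_semicontinuous (f : C -> C) (hf : entire f) (x c : R) :
  0 < x -> 0 <= c < max_modulus f x ->
  exists d : R, 0 < d /\ forall y : R, 0 < y -> Rabs (y - x) < d -> c < max_modulus f y.
Proof.
intros hx h. destruct (max_modulus_gt_witness f x c h) as [[a b] [hz hc]].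
assert (hcont : continuous (fun t => Cmod (f (t * (a / x), t * (b / x)))) x).
{ apply entire_Cmod_curve_continuous; [exact hf| |];
  apply (continuous_mult (K := R_AbsRing));
  (apply continuous_id || apply continuous_const). }
destruct (hcont (fun v => c < v)) as [d hd].
{ apply open_gt. replace (x * (a / x)) with a by (field; lra).
  replace (x * (b / x)) with b by (field; lra). exact hc. }
exists d. split; [apply cond_pos|]. intros y hy hyx.
apply Rlt_le_trans with (1 := hd y hyx).
replace y with (Cmod (y * (a / x), y * (b / x))) at 3; [now apply Cmod_le_max_modulus|].
replace (y * (a / x), y * (b / x)) with (Cmult (RtoC (y / x)) (a, b)).
- rewrite Cmod_mult, hz, Cmod_R, Rabs_pos_eq; [field; lra|].
  left. now apply Rdiv_lt_0_compat.
- unfold Cmult; simpl. f_equal; field; lra.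
Qed.

(** * Unbounded orbits of [M] and [mu2] *)

Lemma max_modulus_iter_unbounded (f : C -> C) (hf : entire f) (a : R) :
  0 < a -> (forall r : R, a <= r -> max_modulus f r > r) ->
  forall B : R, exists n : nat, B <= Nat.iter n (max_modulus f) a.
Proof.
intros ha hg. apply iter_unbounded; [exact hg|].
intros x hx. specialize (hg x hx).
destruct (max_modulus_lower_semicontinuous f hf x x) as (d & hd & h); [lra..|].
exists d. split; [easy|]. intros y hay hy. left. apply h; [lra|].
apply Rabs_def1; lra.
Qed.

Lemma nnpow_nonneg (x a : R) : 0 <= nnpow x a.
Proof.
unfold nnpow. destruct (Rlt_dec 0 x); [left; apply exp_pos|lra].
Qed.

Lemma mu2_iter_unbounded (f : C -> C) (hf : entire f) (eps a : R) :
  0 < eps -> 0 < a ->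
  (forall r : R, a <= r -> mu2 f eps r > r) ->
  forall B : R, exists n : nat, B <= Nat.iter n (mu2 f eps) a.
Proof.
intros he ha hg. apply iter_unbounded; [exact hg|].
intros x hx. specialize (hg x hx).
destruct (Rle_dec x 1) as [hx1|hx1].
(* [mu2] is at least 1 everywhere, since [nnpow] is nonnegative. *)
- exists 1. split; [lra|]. intros y _ _. apply Rle_trans with (1 := hx1).
  rewrite <- exp_0. apply exp_le, nnpow_nonneg.
- assert (hlx : 0 < ln x) by (rewrite <- ln_1; apply ln_increasing; lra).
  assert (hn : ln x < nnpow (ln (max_modulus f x)) eps).
  { apply exp_lt_inv. rewrite exp_ln by lra. exact hg. }
  assert (hL : 0 < ln (max_modulus f x)).
  { revert hn. unfold nnpow. destruct (Rlt_dec _ _); lra. }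
  rewrite nnpow_pos in hn by easy.
  (* [exp c] is the value of [M(y)] at which [mu2 f eps y] equals [x], so semicontinuity of [M]
     transfers to [mu2]. *)
  set (c := Rpower (ln x) (1 / eps)).
  assert (hc : c < ln (max_modulus f x)).
  { replace (ln (max_modulus f x)) with (Rpower (Rpower (ln (max_modulus f x)) eps) (1 / eps)).
    - apply Rlt_Rpower_l; [apply Rdiv_lt_0_compat; lra | lra].
    - rewrite Rpower_mult. replace (eps * (1 / eps)) with 1 by (field; lra).
      now apply Rpower_1. }
  assert (hc' : 0 <= exp c < max_modulus f x).
  { split; [left; apply exp_pos|]. apply ln_pos_arg in hL.
    rewrite <- (exp_ln (max_modulus f x)) by lra. now apply exp_increasing. }
  destruct (max_modulus_lower_semicontinuous f hf x (exp c)) as (d & hd & h); [lra|easy|].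
  exists d. split; [easy|]. intros y hay hy.
  assert (hy' : c < ln (max_modulus f y)).
  { rewrite <- (ln_exp c). apply ln_increasing; [apply exp_pos|].
    apply h; [lra|]. apply Rabs_def1; lra. }
  assert (hc0 : 0 < c) by apply exp_pos.
  unfold mu2. rewrite nnpow_pos by lra.
  rewrite <- (exp_ln x) at 1 by lra. apply exp_le.
  replace (ln x) with (Rpower c eps).
  + apply Rle_Rpower_l; lra.
  + unfold c. rewrite Rpower_mult. replace (1 / eps * eps) with 1 by (field; lra).
    now apply Rpower_1.
Qed.

(** * The two inclusions between [A(f)] and [Q2(f)] *)

Lemma power_growth_fast_escaping_Q2 (f : C -> C) (hf : entire f) (A b r0 : R) :
  0 < A -> 0 < b <= 1 -> 1 <= r0 ->
  (forall r : R, r0 <= r -> Rpower r b <= ln (max_modulus f r) <= Rpower r A) ->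
  forall z : C, fast_escaping f z -> Q2 f z.
Proof.
intros hA hb hr0 hM z (a & ha & hg & l & hl).
set (eps := b / (A + 1)).
assert (heps : 0 < eps < 1).
{ unfold eps. split; [apply Rdiv_lt_0_compat; lra|].
  apply Rmult_lt_reg_r with (A + 1); [lra|]. field_simplify; lra. }
assert (hAe : A * eps <= b).
{ unfold eps. apply Rmult_le_reg_r with (A + 1); [lra|]. field_simplify; [|lra]. nra. }
(* From [ln M(r) >= r ^ b] follows [mu2 f eps r >= exp (r ^ c)], which exceeds [r] from [R1] on. *)
set (c := b * eps).
assert (hc : 0 < c) by (apply Rmult_lt_0_compat; lra).
set (R1 := Rmax r0 (exp (4 / c ^ 2))).
assert (h1 : r0 <= R1) by apply Rmax_l.
assert (h2 : exp (4 / c ^ 2) <= R1) by apply Rmax_r.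
assert (hL : forall r, R1 <= r -> 0 < Rpower r b) by (intros; apply exp_pos).
assert (hmu : forall r, R1 <= r ->
  mu2 f eps r = exp (Rpower (ln (max_modulus f r)) eps)).
{ intros r hr. unfold mu2. rewrite nnpow_pos; [easy|].
  specialize (hL r hr). specialize (hM r). lra. }
assert (hgt : forall r, R1 <= r -> r < mu2 f eps r).
{ intros r hr. rewrite hmu by easy.
  apply Rlt_le_trans with (1 := lt_exp_Rpower c r hc (Rle_trans _ _ _ h2 hr)).
  apply exp_le. unfold c. rewrite <- Rpower_mult.
  specialize (hL r hr). specialize (hM r ltac:(lra)). apply Rle_Rpower_l; lra. }
(* After [m] steps the [M]-orbit of [a] has passed [R1]; adding [m] to [l] lets the [mu2]-orbit of
   [R1] stay below it. *)
destruct (max_modulus_iter_unbounded f hf a ha hg R1) as [m hm].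
exists eps, (m + l)%nat, R1. repeat split; try lra.
- assert (hr' := hM r ltac:(lra)). specialize (hL r H).
  left. apply ln_pos_arg. lra.
- apply hgt; easy.
- intros n. rewrite Nat.add_assoc.
  apply Rge_trans with (1 := hl (n + m)%nat). rewrite Nat.iter_add. apply Rle_ge.
  refine (proj2 (iter_rel (fun s t => R1 <= s /\ s <= t) (mu2 f eps) (max_modulus f)
    R1 _ n _ (conj (Rle_refl R1) hm))).
  intros s t [hs hst]. specialize (hgt s hs). split; [lra|].
  rewrite hmu by easy.
  assert (hs' := hM s ltac:(lra)). assert (ht' := hM t ltac:(lra)).
  assert (hLs := hL s hs). assert (hLt := hL t ltac:(lra)).
  rewrite <- (exp_ln (max_modulus f t)) by (apply Rlt_trans with 1; [lra | apply ln_pos_arg; lra]).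
  apply exp_le.
  apply Rle_trans with (2 := proj1 ht').
  apply Rle_trans with (Rpower (Rpower s A) eps); [apply Rle_Rpower_l; lra|].
  rewrite Rpower_mult.
  apply Rle_trans with (Rpower s b); [apply Rle_Rpower; lra | apply Rle_Rpower_l; lra].
Qed.

Lemma power_growth_Q2_fast_escaping (f : C -> C) (hf : entire f) (A b r0 : R) :
  0 < A -> 0 < b <= 1 -> 1 <= r0 ->
  (forall r : R, r0 <= r -> Rpower r b <= ln (max_modulus f r) <= Rpower r A) ->
  forall z : C, Q2 f z -> fast_escaping f z.
Proof.
intros hA hb hr0 hM z (eps & l & a & heps & ha & hg & hl).
set (k := (A + 1) / (b * eps)).
assert (hbe : 0 < b * eps) by (apply Rmult_lt_0_compat; lra).
assert (hbe1 : b * eps <= 1) by nra.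
assert (hk : 1 <= k).
{ unfold k. apply Rmult_le_reg_r with (b * eps); [lra|]. field_simplify; lra. }
(* [k <= R1] gives [k * ln M(r) <= r * r ^ A]; the last term ensures [M(r) > r]. *)
set (R1 := Rmax r0 (Rmax k (exp (4 / b ^ 2)))).
assert (h1 : r0 <= R1) by apply Rmax_l.
assert (h2 : Rmax k (exp (4 / b ^ 2)) <= R1) by apply Rmax_r.
assert (h3 : k <= R1) by (apply Rle_trans with (2 := h2), Rmax_l).
assert (h4 : exp (4 / b ^ 2) <= R1) by (apply Rle_trans with (2 := h2), Rmax_r).
assert (hL : forall r, r0 <= r -> 0 < ln (max_modulus f r)).
{ intros r hr. assert (0 < Rpower r b) by apply exp_pos. specialize (hM r hr). lra. }
assert (hE : forall r, r0 <= r -> exp (ln (max_modulus f r)) = max_modulus f r).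
{ intros r hr. specialize (hL r hr). apply ln_pos_arg in hL. apply exp_ln. lra. }
assert (hgt : forall r, R1 <= r -> r < max_modulus f r).
{ intros r hr. rewrite <- hE by lra.
  apply Rlt_le_trans with (1 := lt_exp_Rpower b r (proj1 hb) (Rle_trans _ _ _ h4 hr)).
  apply exp_le. apply hM. lra. }
destruct (mu2_iter_unbounded f hf eps a (proj1 heps) ha (fun r hr => proj2 (hg r hr))
  (Rpower R1 k)) as [m hm].
assert (hpow : forall r, R1 <= r -> r <= Rpower r k).
{ intros r hr. rewrite <- (Rpower_1 r) at 1 by lra. apply Rle_Rpower; lra. }
exists R1. repeat split; [lra|exact hgt|].
exists (m + l)%nat. intros n. rewrite Nat.add_assoc.
apply Rge_trans with (1 := hl (n + m)%nat). rewrite Nat.iter_add. apply Rle_ge.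
assert (H : R1 <= Nat.iter n (max_modulus f) R1 /\
  Rpower (Nat.iter n (max_modulus f) R1) k
    <= Nat.iter n (mu2 f eps) (Nat.iter m (mu2 f eps) a)).
(* Carrying [r ^ k <= s] rather than [r <= s] compensates for the exponent [eps] lost in each
   application of [mu2]. *)
{ apply (iter_rel (fun r s => R1 <= r /\ Rpower r k <= s)); [|split; [lra|easy]].
  intros r s [hr hrs]. specialize (hgt r hr). split; [lra|].
  assert (hr1 := hpow r hr).
  assert (hs' := hM s ltac:(lra)). assert (hr' := hM r ltac:(lra)).
  unfold mu2. rewrite nnpow_pos by (apply hL; lra).
  (* Since [M(r) ^ k] is [exp (k * ln M(r))], only exponents remain to be compared. *)
  unfold Rpower at 1. apply exp_le.
  apply Rle_trans with (r * Rpower r A).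
  - apply Rmult_le_compat; try lra. left. apply hL. lra.
  - rewrite <- (Rpower_1 r) at 1 by lra. rewrite <- Rpower_plus.
    replace (1 + A) with (k * (b * eps)) by (unfold k; field; lra).
    apply Rle_trans with (Rpower s (b * eps)).
    + rewrite <- (Rpower_mult r). apply Rle_Rpower_l; [lra|].
      split; [apply exp_pos | easy].
    + rewrite <- Rpower_mult. apply Rle_Rpower_l; [lra|].
      split; [apply exp_pos | easy]. }
destruct H as [H1 H2].
apply Rle_trans with (2 := H2). now apply hpow.
Qed.

Theorem theorem2p2 (f : C -> C)
  (hf : transcendental_entire f)
  (horder : Rbar_lt (growth_order f) p_infty)
  (hlower : Rbar_lt (Finite 0) (growth_lower_order f)) :
  strongly_log_regular f /\ (forall z : C, Q2 f z <-> fast_escaping f z).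
Proof.
destruct hf as [he _].
destruct (growth_bounds f horder hlower) as (A & b & r0 & hA & hb & hr0 & hM).
split; [|intros z; split].
- exact (power_growth_strongly_log_regular f A b r0 hA hb hr0 hM).
- exact (power_growth_Q2_fast_escaping f he A b r0 hA hb hr0 hM z).
- exact (power_growth_fast_escaping_Q2 f he A b r0 hA hb hr0 hM z).
Qed.
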